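(* There is no Euler's magic matrix in $\mathbb{Q}^{3\times 3}$; that is, there is no matrix $M\in\mathbb{Q}^{3\times 3}$ which is an Euler's magic matrix over $\mathbb{Q}$.
   Context: Let $R$ be a commutative ring and $n$ a positive integer. A matrix $M=(m_{i,j})_{1\le i,j\le n}\in R^{n\times n}$ is called an Euler's magic matrix over $R$ if there is some $\gamma\in R\setminus\{0\}$ such that (i) $M\cdot M^t=\gamma\cdot I_n$, where $M^t$ is the transpose of $M$ and $I_n$ is the $n\times n$ identity matrix; (ii) $\sum_{i=1}^n m_{i,i}^2=\gamma$; and (iii) $\sum_{i=1}^n m_{i,n+1-i}^2=\gamma$. *)

(* Defs.v *)
From mathcomp Require Import all_boot all_order all_algebra.

Set Implicit Arguments.
Unset Strict Implicit.
Unset Printing Implicit Defensive.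

Import GRing.Theory.
Local Open Scope ring_scope.

(* With indices running from 0 to n - 1, [rev_ord i] is n - 1 - i, so the
   entries [M i (rev_ord i)] are those of the anti-diagonal. *)
Definition euler_magic (R : comPzRingType) (n : nat) (M : 'M[R]_n) : Prop :=
  exists gamma : R,
    [/\ gamma != 0,
        M *m M^T = gamma%:M,
        \sum_(i < n) M i i ^+ 2 = gamma
      & \sum_(i < n) M i (rev_ord i) ^+ 2 = gamma].

(* Main.v *)
Require Import Defs.
From mathcomp Require Import all_boot all_order all_algebra.
From mathcomp Require Import ring.

Set Implicit Arguments.
Unset Strict Implicit.
Unset Printing Implicit Defensive.

Import GRing.Theory Num.Theory.

Local Open Scope ring_scope.

(** The four corners, the middle row and the middle column cover the matrix,
    with only the centre [c] covered twice; comparing the total sum of squares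
    [3 * gamma] with the two diagonal conditions gives [gamma = 3 * c ^+ 2].
    But [gamma ^+ 3 = (\det M) ^+ 2], so [gamma] is a nonzero rational square,
    and [3] would be one too. *)

(** The exponent of [p] is even on the left and odd on the right; for [a = 0] the convention
    [logn p 0 = 0] still gives an even value. *)
Lemma sqr_neq_prime_mul_sqr (p a b : nat) :
  prime p -> (0 < b)%N -> (a ^ 2 <> p * b ^ 2)%N.
Proof.
move=> p_pr b_gt0 eq_ab.
have p_gt0 := prime_gt0 p_pr.
have /(congr1 odd) := congr1 (logn p) eq_ab.
rewrite lognM ?expn_gt0 ?b_gt0 // (logn_prime _ p_pr) eqxx !lognX.
by rewrite oddD !oddM.
Qed.

Lemma sqr_rat_neq_prime (p : nat) (x : rat) : prime p -> x ^+ 2 <> p%:R.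
Proof.
move=> p_pr x2p.
have den_neq0 : (denq x)%:~R != 0 :> rat by rewrite intr_eq0 denq_neq0.
have eq_q : (numq x)%:~R ^+ 2 = p%:R * (denq x)%:~R ^+ 2 :> rat.
  by rewrite -x2p -exprMn -[X in (X * _) ^+ 2]divq_num_den divfK.
have eq_z : numq x ^+ 2 = p%:Z * denq x ^+ 2.
  by apply: (@intr_inj rat); rewrite rmorphXn rmorphM rmorphXn.
have den_gt0 : (0 < `|denq x|)%N by rewrite absz_gt0 denq_neq0.
apply: (@sqr_neq_prime_mul_sqr p `|numq x|%N `|denq x|%N p_pr den_gt0).
by rewrite -!abszX eq_z abszM.
Qed.

Lemma gram_diag (R : pzRingType) (m n : nat) (A : 'M[R]_(m, n)) (i : 'I_m) :
  (A *m A^T) i i = \sum_j A i j ^+ 2.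
Proof. by rewrite mxE; apply: eq_bigr => j _; rewrite mxE expr2. Qed.

(** After division by [c], a one-sided inverse of a square matrix is two-sided. With [M] and [M^T]
    this carries the row norms over to the columns. *)
Lemma mulmx_scalarC (F : fieldType) (n : nat) (A B : 'M[F]_n) (c : F) :
  c != 0 -> A *m B = c%:M -> B *m A = c%:M.
Proof.
move=> c_neq0 AB.
have /mulmx1C : (c^-1 *: A) *m B = 1%:M.
  by rewrite -scalemxAl AB scale_scalar_mx mulVf.
rewrite -scalemxAr => /(canRL (scalerKV c_neq0)) ->.
by rewrite scale_scalar_mx mulr1.
Qed.

Lemma euler_magic3_center (F : fieldType) (M : 'M[F]_3) (gamma : F) :
  gamma != 0 -> M *m M^T = gamma%:M ->
  \sum_(i < 3) M i i ^+ 2 = gamma ->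
  \sum_(i < 3) M i (rev_ord i) ^+ 2 = gamma ->
  gamma = 3%:R * M 1 1 ^+ 2.
Proof.
move=> gamma_neq0 MMt diag anti.
have row_norm i : \sum_j M i j ^+ 2 = gamma.
  by rewrite -gram_diag MMt mxE eqxx.
have col_norm : \sum_i M i 1 ^+ 2 = gamma.
  have := gram_diag M^T 1.
  rewrite trmxK (mulmx_scalarC gamma_neq0 MMt) mxE eqxx mulr1n => ->.
  by apply: eq_bigr => j _; rewrite mxE.
(* One normal form for the indices of the unrolled sums, so that [ring] identifies equal entries. *)
have ord3 : (lift ord0 ord0 = 1 :> 'I_3) * (lift ord0 (lift ord0 ord0) = 2%:R :> 'I_3)
  * (rev_ord 0 = 2%:R :> 'I_3) * (rev_ord 1 = 1 :> 'I_3)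
  * (rev_ord 2%:R = 0 :> 'I_3) * (ord0 = 0 :> 'I_3).
  by do !split; apply: val_inj.
(* The two diagonals and the middle column together cover each entry of the outer rows once and the
   centre three times. *)
have -> : 3%:R * M 1 1 ^+ 2 =
    \sum_i M i i ^+ 2 + \sum_i M i (rev_ord i) ^+ 2 + \sum_i M i 1 ^+ 2
    - \sum_j M 0 j ^+ 2 - \sum_j M 2%:R j ^+ 2.
  by rewrite !big_ord_recl !big_ord0 !ord3; ring.
by rewrite diag anti col_norm !row_norm; ring.
Qed.

Theorem theorem1p2 : ~ exists M : 'M[rat]_3, euler_magic M.
Proof.
case=> M [gamma [gamma_neq0 MMt diag anti]].
have center := euler_magic3_center gamma_neq0 MMt diag anti.
have det2 : \det M ^+ 2 = gamma ^+ 3.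
  by rewrite -det_scalar -MMt det_mulmx det_tr expr2.
have c_neq0 : M 1 1 != 0.
  by apply: contra_neq gamma_neq0 => c0; rewrite center c0 expr0n mulr0.
(* By [det2] this quotient squares to [gamma / M 1 1 ^+ 2], which is 3 by [center]. *)
apply: (@sqr_rat_neq_prime 3 (\det M / (gamma * M 1 1))) => //.
have -> : (\det M / (gamma * M 1 1)) ^+ 2 = gamma / M 1 1 ^+ 2.
  by rewrite expr_div_n det2; field; rewrite c_neq0 gamma_neq0.
by rewrite center mulfK ?expf_neq0.
Qed.
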